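(* Let $\mathbb{F}$ be an infinite field of characteristic $p$, and let $n\geq 2$ and $d\geq 2$ be integers. (a) If $2<p\leq n$, then $D(R^{O(n)})\geq d$ and $D(R_{+}^{O(n)})\geq d$. (b) If $2<p\leq \frac{n-1}{2}$, then $D(R_{-}^{O(n)})\geq d-1$.
   Context: Let $R=R_{n,d}=\mathbb{F}[x_{ij}(k)\,|\,1\leq i,j\leq n,\ 1\leq k\leq d]$ be the polynomial algebra, graded by total degree. For $1\leq k\leq d$ let $X_k$ be the generic $n\times n$ matrix with $(i,j)$ entry $x_{ij}(k)$. Let $X_k^{+}$ be the symmetric generic matrix: $(X_k^{+})_{ij}=x_{ij}(k)$ if $i\geq j$ and $(X_k^{+})_{ij}=x_{ji}(k)$ if $i<j$. Let $X_k^{-}$ be the skew-symmetric generic matrix: $(X_k^{-})_{ij}=x_{ij}(k)$ if $i>j$, $(X_k^{-})_{ij}=0$ if $i=j$, and $(X_k^{-})_{ij}=-x_{ji}(k)$ if $i<j$. For an $n\times n$ matrix $A$, $\sigma_t(A)$ ($1\le t\le n$) denotes the $t$-th coefficient of the characteristic polynomial of $A$ (so $\sigma_1=\mathrm{tr}$ and $\sigma_n=\det$). $R^{O(n)}$ is the unital $\mathbb{F}$-subalgebra of $R$ generated by all $\sigma_t(A)$, where $1\leq t\leq n$ and $A$ ranges over all monomials in $X_1,\ldots,X_d,X_1^T,\ldots,X_d^T$. $R_{+}^{O(n)}$ (respectively $R_{-}^{O(n)}$) is the unital subalgebra of $R$ generated by all $\sigma_t(A)$, $1\le t\le n$, where $A$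 ranges over all monomials in $X_1^{+},\ldots,X_d^{+}$ (respectively in $X_1^{-},\ldots,X_d^{-}$). All are $\mathbb{N}$-graded by degree with degree-zero component $\mathbb{F}$. For an $\mathbb{N}$-graded unital algebra $\mathcal{A}$ with degree-zero component $\mathbb{F}$, let $\mathcal{A}^{+}$ be the subalgebra (without unit) generated by the homogeneous elements of positive degree. An element of $\mathcal{A}$ is decomposable if it lies in $(\mathcal{A}^{+})^2$, and indecomposable otherwise. $D(\mathcal{A})$ denotes the highest degree of (homogeneous, positive-degree) indecomposable elements of $\mathcal{A}$; equivalently, the least upper bound of the degrees of the elements of a minimal (by inclusion) homogeneous system of generators of $\mathcal{A}$ as a unital algebra. *)

(* Defs.v *)
From HB Require Import structures.
From mathcomp Require Import all_boot all_order all_algebra.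
From mathcomp Require Import mpoly.
From mathcomp Require Import boolp.

Set Implicit Arguments.
Unset Strict Implicit.
Unset Printing Implicit Defensive.

Import GRing.Theory.
Local Open Scope ring_scope.

Inductive unital_subalg (F : nzRingType) (A : lalgType F) (S : A -> Prop) :
    A -> Prop :=
| usub_gen f of S f : unital_subalg S f
| usub_scalar (c : F) : unital_subalg S c%:A
| usub_add f g of unital_subalg S f & unital_subalg S g :
    unital_subalg S (f + g)
| usub_mul f g of unital_subalg S f & unital_subalg S g :
    unital_subalg S (f * g).

Inductive nonunital_subalg (F : nzRingType) (A : lalgType F) (S : A -> Prop) :
    A -> Prop :=
| nsub_gen f of S f : nonunital_subalg S f
| nsub_zero : nonunital_subalg S 0
| nsub_scale (c : F) f of nonunital_subalg S f : nonunital_subalg S (c *: f)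
| nsub_add f g of nonunital_subalg S f & nonunital_subalg S g :
    nonunital_subalg S (f + g)
| nsub_mul f g of nonunital_subalg S f & nonunital_subalg S g :
    nonunital_subalg S (f * g).

(* Finite sums suffice: the first factor absorbs the scalars. *)
Definition square (F : nzRingType) (A : lalgType F) (S : A -> Prop) (f : A) :
    Prop :=
  exists2 s : seq (A * A),
    (forall u, u \in s -> S u.1 /\ S u.2) & f = \sum_(u <- s) u.1 * u.2.

Section Graded.
Variables (N : nat) (F : fieldType).
Implicit Types (A : {mpoly F[N]} -> Prop) (f : {mpoly F[N]}).

Definition positive_part A : {mpoly F[N]} -> Prop :=
  nonunital_subalg (fun f => A f /\ exists2 e, (0 < e)%N & f \is e.-homog).

Definition decomposable A f : Prop := square (positive_part A) f.

Definition indecomposable A f : Prop := A f /\ ~ decomposable A f.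

Definition indecomposable_degree A (e : nat) : Prop :=
  (0 < e)%N /\ exists2 f, f \is e.-homog & indecomposable A f.

(* [option nat] stands for the natural numbers extended with infinity [None].
   The value is the least upper bound of the degrees of the homogeneous
   indecomposable elements: their maximum when there are some and their degrees
   are bounded, and [Some 0] when there are none. *)
Definition D A : option nat :=
  if pselect (exists m, `[< forall e, indecomposable_degree A e -> (e <= m)%N >])
    is left ex_bound then Some (ex_minn ex_bound) else None.

End Graded.

Definition leq_infty (m : nat) (b : option nat) : bool :=
  if b is Some k then (m <= k)%N else true.

(* The sign makes sigma_1 the trace and sigma_n the determinant. *)
Definition sigma (R : comNzRingType) (n t : nat) (A : 'M[R]_n) : R :=
  (-1) ^+ t * (char_poly A)`_(n - t).

(* The empty word gives a scalar, which lies in the subalgebra anyway. *)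
Definition sigma_algebra (F : fieldType) (N n : nat) (I : Type)
    (Y : I -> 'M[{mpoly F[N]}]_n) : {mpoly F[N]} -> Prop :=
  unital_subalg (fun f => exists (t : nat) (w : seq I),
    (1 <= t <= n)%N /\ f = sigma t (\prod_(k <- w) Y k)).

Section GenericMatrices.
Variables (F : fieldType) (n d : nat).

Definition nvars : nat := #|{: 'I_n * 'I_n * 'I_d}|.

Definition x (i j : 'I_n) (k : 'I_d) : {mpoly F[nvars]} :=
  'X_(enum_rank (i, j, k)).

Definition X (k : 'I_d) : 'M[{mpoly F[nvars]}]_n := \matrix_(i, j) x i j k.

Definition Xplus (k : 'I_d) : 'M[{mpoly F[nvars]}]_n :=
  \matrix_(i, j) if (j <= i)%N then x i j k else x j i k.

Definition Xminus (k : 'I_d) : 'M[{mpoly F[nvars]}]_n :=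
  \matrix_(i, j) if (j < i)%N then x i j k
                 else if i == j then 0 else - x j i k.

Definition RO : {mpoly F[nvars]} -> Prop :=
  sigma_algebra (fun k : 'I_d + 'I_d =>
    match k with inl k => X k | inr k => (X k)^T end).

Definition ROplus : {mpoly F[nvars]} -> Prop := sigma_algebra Xplus.

Definition ROminus : {mpoly F[nvars]} -> Prop := sigma_algebra Xminus.

End GenericMatrices.

Arguments RO : clear implicits.
Arguments ROplus : clear implicits.
Arguments ROminus : clear implicits.

(* Main.v *)
Require Import Defs.
From HB Require Import structures.
From mathcomp Require Import all_boot all_order all_algebra.
From mathcomp Require Import mpoly.
From mathcomp Require classical_sets cardinality.
From mathcomp Require boolp.

Set Implicit Arguments.
Unset Strict Implicit.

Import GRing.Theory.

(** The indecomposable element is the trace of a product of distinct generic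
    matrices.  It survives a specialization of the generic matrices to nilpotent
    multiples of two constant matrices, and that specialization kills every
    product of two invariants without constant term.

    Let C be the truncated polynomial algebra on letters a_k with a_k^2 = 0.
    Send the generic matrix number 0 to a_0 E and every other one, of number k,
    to a_k P, where E and P are matrices over F such that every positive power
    of P has trace 0 while tr (E P^e) is nonzero.  A nonempty word with product
    A specializes to c M, where c is the monomial of its letters and M is a
    matrix over F, so sigma_t (A) goes to c^t sigma_t (M) ([sigmaZ]).
    - If the letter 0 occurs in the word, a_0 divides c.
    - If it does not and t >= 2, then c^t = 0 because the letters have square 0.
    - If it does not and t = 1, then sigma_t (M) is the trace of a positive
      power of P, which is 0.
    So the whole algebra of invariants is sent into F + a_0 C
    ([marked_sigma_algebra]), its elements without constant term into a_0 C
    ([marked_positive_part]), and the decomposable ones into (a_0 C)^2 = 0.  But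
    the trace of X_0 X_1 ... X_e goes to a_0 a_1 ... a_e tr (E P^e), which is
    nonzero, hence this trace is indecomposable ([trace_indecomposable]).

    Characteristic p enters through the existence of P.  In the general and
    symmetric cases P is the identity matrix of size p bordered by zeros: it is
    idempotent of trace p = 0.  The matrix E keeps only its first diagonal
    entry, and e is arbitrary, so the degree d is attained.  In the
    skew-symmetric case both are tensored with the skew matrix J of size 2,
    whence the condition 2p <= n.  As tr (J^m) is 0 for odd m and 2 or -2 for
    even m, only words of even length survive, which costs at most one degree.
    The characteristic must differ from 2 there. *)

(** * Coefficients of the characteristic polynomial *)

Section CharacteristicCoefficients.
Local Open Scope ring_scope.

Lemma sigma1_trace (R : comNzRingType) (n : nat) (A : 'M[R]_n) :
  (0 < n)%N -> sigma 1 A = \tr A.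
Proof.
by move=> n_gt0; rewrite /sigma subn1 char_poly_trace // expr1 mulN1r opprK.
Qed.

Lemma sigma_map (R S : comNzRingType) (f : {rmorphism R -> S}) (n t : nat)
    (A : 'M[R]_n) : sigma t (map_mx f A) = f (sigma t A).
Proof. by rewrite /sigma -map_char_poly coef_map rmorphM rmorphXn rmorphN1. Qed.

Lemma char_polyZ (R : comNzRingType) (n : nat) (c : R) (A : 'M[R]_n) :
  char_poly (c *: A) \Po (c *: 'X) = c ^+ n *: char_poly A.
Proof.
rewrite /char_poly -det_map_mx.
have -> : map_mx (comp_poly (c *: 'X)) (char_poly_mx (c *: A))
          = c%:P *: char_poly_mx A.
  apply/matrixP=> i j; rewrite !mxE /= rmorphB /= rmorphMn /=.
  by rewrite comp_polyX comp_polyC polyCM mulrBr mulrnAr !mul_polyC.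
by rewrite detZ -rmorphXn /= mul_polyC.
Qed.

(** Substituting c X for X in X - c A gives c (X - A), and taking determinants
    gives [char_polyZ]; comparing coefficients leaves a factor c^(n - t) on both
    sides, and cancelling it is where c has to be regular. *)
Lemma sigmaZ (R : idomainType) (n t : nat) (c : R) (A : 'M[R]_n) :
  c != 0 -> (t <= n)%N -> sigma t (c *: A) = c ^+ t * sigma t A.
Proof.
move=> c_neq0 le_tn; rewrite /sigma mulrCA; congr (_ * _).
have := congr1 (fun q : {poly R} => q`_(n - t)) (char_polyZ c A).
have coef_dilate (q : {poly R}) m : (q \Po (c *: 'X))`_m = q`_m * c ^+ m.
  rewrite coef_comp_poly; have [lt_mq | le_qm] := ltnP m (size q); last first.
    rewrite nth_default // mul0r big1 // => i _.
    rewrite exprZn coefZ coefXn (gtn_eqF (leq_trans (ltn_ord i) le_qm)).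
    by rewrite !mulr0.
  rewrite (bigD1 (Ordinal lt_mq)) //= exprZn coefZ coefXn eqxx mulr1.
  rewrite big1 ?addr0 // => i ne_im; rewrite exprZn coefZ coefXn.
  by rewrite eq_sym -[m]/(val (Ordinal lt_mq)) val_eqE (negPf ne_im) !mulr0.
rewrite /= coef_dilate coefZ.
have -> : c ^+ n = c ^+ (n - t) * c ^+ t by rewrite -exprD subnK.
rewrite -mulrA mulrC.
by move/(mulfI (expf_neq0 _ c_neq0)).
Qed.

End CharacteristicCoefficients.

(** * Truncated polynomials *)

Section Truncation.
Local Open Scope ring_scope.
Variables (F : fieldType) (d : nat) (T : 'X_{1..d}).
Implicit Types (u v g h : {mpoly F[d]}).

(** The elements of the largest ideal whose members do not involve the monomial
    T.  When T is squarefree this ideal contains the square of each variable, so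
    working modulo it amounts to working in the truncated algebra on the letters
    of T, without forming a quotient. *)
Definition negligible h : Prop := forall g, (g * h)@_T = 0.

Lemma negligibleD u v : negligible u -> negligible v -> negligible (u + v).
Proof. by move=> u0 v0 g; rewrite mulrDr mcoeffD u0 v0 addr0. Qed.

Lemma negligibleMl g u : negligible u -> negligible (g * u).
Proof. by move=> u0 h; rewrite mulrA u0. Qed.

Lemma negligible0 : negligible 0.
Proof. by move=> g; rewrite mulr0 mcoeff0. Qed.

Lemma negligible_monomial (m : 'X_{1..d}) k :
  (T k < m k)%N -> negligible 'X_[m].
Proof.
move=> ltTm g; apply/eqP; rewrite mcoeff_eq0 (perm_mem (msuppMX g m)).
by apply: contraTN ltTm => /mapP[m' _ ->]; rewrite -leqNgt mnmDE leq_addr.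
Qed.

Lemma negligible_const u : negligible u -> u@_0 = 0.
Proof. by move/(_ 'X_[T]); rewrite mulrC -{1}[T]addm0 mcoeffMX. Qed.

Variable k0 : 'I_d.

(** Membership in the ideal a_0 C of the truncated algebra C, where a_0 is the
    variable of index k0. *)
Definition marked u : Prop := exists g, negligible (u - 'X_k0 * g).

Lemma negligible_marked u : negligible u -> marked u.
Proof. by move=> u0; exists 0; rewrite mulr0 subr0. Qed.

Lemma marked0 : marked 0.
Proof. exact/negligible_marked/negligible0. Qed.

Lemma marked_generator g : marked ('X_k0 * g).
Proof. by exists g; rewrite subrr; apply: negligible0. Qed.

Lemma markedD u v : marked u -> marked v -> marked (u + v).
Proof.
move=> [g ug] [h vh]; exists (g + h).
by rewrite mulrDr opprD addrACA; apply: negligibleD.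
Qed.

Lemma markedMl g u : marked u -> marked (g * u).
Proof.
move=> [h uh]; exists (g * h).
by rewrite mulrCA -mulrBr; apply: negligibleMl.
Qed.

Lemma marked_const u : marked u -> u@_0 = 0.
Proof.
case=> g /negligible_const; rewrite mcoeffB mulrC.
rewrite rmorphM /= mcoeffX -mdeg_eq0 mdeg1 mulr0 subr0; exact.
Qed.

(** The ideal a_0 C has square zero because a_0 does; this is what kills
    decomposable elements. *)
Lemma negligible_markedM u v : (T k0 <= 1)%N ->
  marked u -> marked v -> negligible (u * v).
Proof.
move=> Tk0 [g ug] [h vh].
have -> : u * v = v * (u - 'X_k0 * g) + 'X_k0 * g * (v - 'X_k0 * h)
    + g * h * ('X_k0 * 'X_k0).
  rewrite !mulrBr [v * u]mulrC [v * _]mulrC addrA subrK.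
  by rewrite mulrACA [X in _ - X]mulrC subrK.
apply: negligibleD; first by apply: negligibleD; apply: negligibleMl.
rewrite -mpolyXD; apply/negligibleMl/(negligible_monomial (k := k0)).
by rewrite mnmDE mnm1E eqxx.
Qed.

End Truncation.

(** * Invariants under a nilpotent specialization *)

Section Specialization.
Local Open Scope ring_scope.
Variables (F : fieldType) (N d n : nat) (I : Type).
Variables (Y : I -> 'M[{mpoly F[N]}]_n).
Variables (theta : {rmorphism {mpoly F[N]} -> {mpoly F[d]}}).
Variables (letter : I -> 'I_d) (Q : 'I_d -> 'M[F]_n) (k0 : 'I_d).
Hypothesis theta_const : forall c, theta c%:MP = c%:MP.
Hypothesis theta_aug : forall f, (theta f)@_0 = f@_0.
Hypothesis theta_Y : forall i,
  map_mx theta (Y i) = 'X_(letter i) *: map_mx (@mpolyC d F) (Q (letter i)).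
Hypothesis traceless : forall s, s != [::] -> k0 \notin s ->
  \tr (\prod_(k <- s) Q k) = 0.

Lemma theta_word w :
  map_mx theta (\prod_(i <- w) Y i) =
  'X_[\sum_(k <- map letter w) U_(k)]
    *: map_mx (@mpolyC d F) (\prod_(k <- map letter w) Q k).
Proof.
elim: w => [|i w IHw]; first by rewrite !big_nil mpolyX0 scale1r !map_mx1.
rewrite /= !big_cons !map_mxM IHw theta_Y mpolyXD.
by rewrite -scalemxAl -scalemxAr scalerA.
Qed.

Lemma theta_sigma t w : (t <= n)%N ->
  theta (sigma t (\prod_(i <- w) Y i)) =
  'X_[\sum_(k <- map letter w) U_(k)] ^+ t
    * (sigma t (\prod_(k <- map letter w) Q k))%:MP.
Proof.
move=> le_tn; rewrite -sigma_map theta_word sigmaZ ?sigma_map //.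
by rewrite -msupp_eq0 msuppX.
Qed.

Lemma count_sumU (s : seq 'I_d) k : (\sum_(j <- s) U_(j))%MM k = count_mem k s.
Proof.
rewrite mnm_sumE -sum1_count [RHS]big_mkcond /=.
by apply: eq_bigr => j _; rewrite mnm1E; case: eqP.
Qed.

(** The scalar c is there for the empty word only. *)
Lemma marked_sigma (T : 'X_{1..d}) t w : (forall k, T k <= 1)%N ->
  (1 <= t <= n)%N ->
  exists c : F, marked T k0 (theta (sigma t (\prod_(i <- w) Y i)) - c%:MP).
Proof.
move=> T_le1 /andP[t_gt0 le_tn]; rewrite theta_sigma //.
set s := map letter w; have [-> | s_neq0] := eqVneq s [::].
  exists (sigma t (1%:M : 'M[F]_n)).
  by rewrite !big_nil mpolyX0 expr1n mul1r subrr; apply: marked0.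
exists 0; rewrite mpolyC0 subr0.
rewrite mpolyXn; have [k0_s | k0_notin] := boolP (k0 \in s).
  set m := (_ *+ t)%MM; have le_m : (U_(k0) <= m)%MM.
    rewrite lep1mP mulmnE count_sumU muln_eq0 negb_or -!lt0n.
    by rewrite -has_count has_pred1 k0_s.
  by rewrite -(submK le_m) addmC mpolyXD -mulrA; apply: marked_generator.
apply: negligible_marked; rewrite mulrC.
case: t t_gt0 le_tn => [//|[|t]] _ le_tn.
  by rewrite sigma1_trace // traceless // mpolyC0 mul0r; apply: negligible0.
apply: negligibleMl; case: s s_neq0 {k0_notin} => [//|k s] _.
apply: (negligible_monomial (k := k)); apply: leq_ltn_trans (T_le1 k) _.
by rewrite mulmnE count_sumU /= eqxx mulSn !addSn.
Qed.

(** F + a_0 C is a subalgebra, so it suffices to know the generators. *)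
Lemma marked_sigma_algebra (T : 'X_{1..d}) f : (forall k, T k <= 1)%N ->
  sigma_algebra Y f -> exists c : F, marked T k0 (theta f - c%:MP).
Proof.
move=> T_le1; elim=> {f} [f [t [w [t_range ->]]] | c | f g _ [a fa] _ [b gb]
    | f g _ [a fa] _ [b gb]].
- exact: marked_sigma.
- by exists c; rewrite alg_mpolyC theta_const subrr; apply: marked0.
- by exists (a + b); rewrite rmorphD mpolyCD opprD addrACA; apply: markedD.
exists (a * b); rewrite rmorphM mpolyCM.
have -> : theta f * theta g - a%:MP * b%:MP
  = theta g * (theta f - a%:MP) + a%:MP * (theta g - b%:MP).
  by rewrite !mulrBr addrA [theta g * a%:MP]mulrC subrK mulrC.
by apply: markedD; apply: markedMl.
Qed.

(** A homogeneous element of positive degree has constant coefficient 0, and so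
    has its specialization; hence the scalar in its decomposition along
    F + a_0 C vanishes. *)
Lemma marked_positive_part (T : 'X_{1..d}) f : (forall k, T k <= 1)%N ->
  positive_part (sigma_algebra Y) f -> marked T k0 (theta f).
Proof.
move=> T_le1; elim=> {f} [f [Yf [e e_gt0 f_homog]] | | c f _ IHf
    | f g _ IHf _ IHg | f g _ _ _ IHg].
- have [c fc] := marked_sigma_algebra T_le1 Yf.
  have f0 : f@_0 = 0.
    by apply: (dhomog_nemf_coeff f_homog); rewrite /= mdeg0 eq_sym -lt0n.
  have := marked_const fc; rewrite mcoeffB theta_aug f0 mcoeffC eqxx mulr1 sub0r.
  by move/eqP; rewrite oppr_eq0 => /eqP c0; rewrite c0 mpolyC0 subr0 in fc.
- by rewrite rmorph0; apply: marked0.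
- by rewrite -mul_mpolyC rmorphM; apply: markedMl.
- by rewrite rmorphD; apply: markedD.
by rewrite rmorphM; apply: markedMl.
Qed.

(** With T the product of the letters of w, the specialized trace is a nonzero
    multiple of X^T, whereas decomposable elements become negligible. *)
Lemma trace_indecomposable w : (0 < n)%N -> uniq (map letter w) ->
  \tr (\prod_(k <- map letter w) Q k) != 0 ->
  ~ decomposable (sigma_algebra Y) (\tr (\prod_(i <- w) Y i)).
Proof.
move=> n_gt0 uniq_w tr_neq0 [s s_pos def_tr].
pose T := (\sum_(k <- map letter w) U_(k))%MM.
have T_le1 k : (T k <= 1)%N by rewrite count_sumU count_uniq_mem // leq_b1.
have : negligible T (theta (\tr (\prod_(i <- w) Y i))).
  rewrite def_tr; elim: s s_pos {def_tr} => [|u s IHs] s_pos.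
    by rewrite big_nil rmorph0; apply: negligible0.
  rewrite big_cons rmorphD rmorphM; apply: negligibleD.
    have [u1 u2] := s_pos u (mem_head u s).
    by apply: (negligible_markedM (k0 := k0)) => //; apply: marked_positive_part.
  by apply: IHs => v vs; apply: s_pos; rewrite inE vs orbT.
move/(_ 1); rewrite mul1r -sigma1_trace // theta_sigma // expr1 mulrC.
rewrite -[X in _@_X]addm0 mcoeffMX mcoeffC eqxx mulr1 sigma1_trace //.
by move/eqP; apply/negP.
Qed.

End Specialization.

(** * Degrees *)

Section Degrees.
Local Open Scope ring_scope.
Variables (F : fieldType) (N : nat).

Lemma word_homog (n : nat) (I : Type) (Y : I -> 'M[{mpoly F[N]}]_n) w :
  (forall k i j, Y k i j \is 1.-homog) ->
  forall i j, (\prod_(k <- w) Y k) i j \is (size w).-homog.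
Proof.
move=> Y_homog; elim: w => [|k w IHw] i j.
  by rewrite big_nil mxE; case: (i == j); rewrite ?mulr0n ?rpred0 ?dhomog1.
rewrite big_cons mxE rpred_sum // => l _.
by rewrite -[size _]add1n dhomogM.
Qed.

Lemma leq_infty_D (A : {mpoly F[N]} -> Prop) e :
  indecomposable_degree A e -> leq_infty e (D A).
Proof.
move=> A_e; rewrite /D; case: boolp.pselect => //= ex_bound.
by case: ex_minnP => m /boolp.asboolP/(_ e A_e).
Qed.

Lemma leq_infty_trans m e b : (m <= e)%N -> leq_infty e b -> leq_infty m b.
Proof. by case: b => //= k; apply: leq_trans. Qed.

End Degrees.

(** * The specialization of the generic entries *)

Section GenericSpecialization.
Local Open Scope ring_scope.
Variables (F : fieldType) (n d : nat) (Q : 'I_d.+1 -> 'M[F]_n).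

Definition generic_value (v : 'I_(nvars n d.+1)) : {mpoly F[d.+1]} :=
  let: (i, j, k) := enum_val v in Q k i j *: 'X_k.

Definition specialize : {mpoly F[nvars n d.+1]} -> {mpoly F[d.+1]} :=
  mmap (@mpolyC d.+1 F) generic_value.
HB.instance Definition _ := GRing.RMorphism.on specialize.

Lemma specialize_x i j k : specialize (x F i j k) = Q k i j *: 'X_k.
Proof. by rewrite /specialize mmapX mmap1U /generic_value enum_rankK. Qed.

Lemma specialize_const c : specialize c%:MP = c%:MP.
Proof. exact: mmapC. Qed.

(** Each variable goes to a multiple of a letter, so no monomial other than 1
    contributes to the constant coefficient. *)
Lemma specialize_aug f : (specialize f)@_0 = f@_0.
Proof.
rewrite /specialize /mmap raddf_sum /=.
have aug_mmap1 m : (mmap1 generic_value m)@_0 = (m == 0%MM)%:R.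
  have [-> | m_neq0] := eqVneq; first by rewrite mmap11 mcoeffC eqxx mulr1.
  have /existsP[v m_v]: [exists v, m v != 0%N].
    apply: contraNT m_neq0; rewrite negb_exists => /forallP m0.
    by apply/eqP/mnmP=> v; rewrite mnm0E; apply/eqP/negPn.
  rewrite /mmap1 rmorph_prod (bigD1 v) //= rmorphXn /=.
  suff -> : (generic_value v)@_0 = 0 by rewrite expr0n (negPf m_v) mul0r.
  rewrite /generic_value; case: (enum_val v) => [[i j] k].
  by rewrite mcoeffZ mcoeffX -mdeg_eq0 mdeg1 mulr0.
under eq_bigr do rewrite rmorphM /= mcoeffC eqxx mulr1 aug_mmap1.
have [f0 | f0] := boolP (0%MM \in msupp f).
  rewrite (bigD1_seq 0%MM) ?msupp_uniq //= eqxx mulr1 big1 ?addr0 // => m.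
  by move/negPf->; rewrite mulr0.
rewrite big_seq big1 => [|m m_f]; first by apply/esym/eqP; rewrite mcoeff_eq0.
by case: eqVneq m_f => [-> | _ _]; rewrite ?(negPf f0) // mulr0.
Qed.

Hypothesis traceless : forall s, s != [::] -> ord0 \notin s ->
  \tr (\prod_(k <- s) Q k) = 0.

Lemma generic_trace_degree (I : Type) (Y : I -> 'M[{mpoly F[nvars n d.+1]}]_n)
    (letter : I -> 'I_d.+1) (w : seq I) :
  (0 < n)%N ->
  (forall k i j, Y k i j \is 1.-homog) ->
  (forall k, map_mx specialize (Y k)
     = 'X_(letter k) *: map_mx (@mpolyC d.+1 F) (Q (letter k))) ->
  uniq (map letter w) -> (0 < size w)%N ->
  \tr (\prod_(k <- map letter w) Q k) != 0 ->
  indecomposable_degree (sigma_algebra Y) (size w).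
Proof.
move=> n_gt0 Y_homog Y_spec uniq_w w_gt0 tr_neq0; split=> //.
exists (\tr (\prod_(k <- w) Y k)).
  by rewrite rpred_sum // => i _; apply: word_homog.
split; last first.
  exact: (trace_indecomposable (theta := specialize) specialize_const
    specialize_aug Y_spec traceless).
apply: usub_gen; exists 1%N, w; split; first by rewrite n_gt0.
by rewrite sigma1_trace.
Qed.

End GenericSpecialization.

(** * Specializations to two matrices *)

Section Pencil.
Local Open Scope ring_scope.
Variables (F : fieldType) (n d : nat) (E P : 'M[F]_n).

Definition pencil (k : 'I_d.+1) : 'M[F]_n := if k == ord0 then E else P.

Lemma prod_pencil s : ord0 \notin s -> \prod_(k <- s) pencil k = P ^+ size s.
Proof.
elim: s => [|k s IHs]; first by rewrite big_nil.
rewrite inE negb_or eq_sym => /andP[k_neq0 s_neq0].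
by rewrite big_cons IHs // /pencil (negPf k_neq0) exprS.
Qed.

(** The word is X_0 X_1 ... X_e; [spell] picks for each letter the matrix of the
    family Y by which it is written, as Y may contain a matrix and its
    transpose. *)
Lemma pencil_degree (I : Type) (Y : I -> 'M[{mpoly F[nvars n d.+1]}]_n)
    (letter : I -> 'I_d.+1) (spell : 'I_d.+1 -> I) (e : nat) :
  (0 < n)%N -> cancel spell letter ->
  (forall k i j, Y k i j \is 1.-homog) ->
  (forall k, map_mx (specialize pencil) (Y k)
     = 'X_(letter k) *: map_mx (@mpolyC d.+1 F) (pencil (letter k))) ->
  (forall m, \tr (P ^+ m.+1) = 0) -> (e <= d)%N -> \tr (E * P ^+ e) != 0 ->
  indecomposable_degree (sigma_algebra Y) e.+1.
Proof.
move=> n_gt0 spellK Y_homog Y_spec trP le_ed trEP.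
pose s : seq 'I_d.+1 := [seq lift ord0 k | k <- take e (enum 'I_d)].
have size_s : size s = e by rewrite size_map size_takel // size_enum_ord.
have s_neq0 : ord0 \notin s by apply/mapP=> -[k _] /eqP; rewrite eq_liftF.
have uniq_s : uniq s.
  by rewrite map_inj_uniq ?take_uniq ?enum_uniq //; apply: lift_inj.
pose w := map spell (ord0 :: s).
have letter_w : map letter w = ord0 :: s.
  by rewrite -map_comp map_id_in // => k _ /=.
have size_w : size w = e.+1 by rewrite size_map /= size_s.
rewrite -size_w; apply: (generic_trace_degree _ n_gt0 Y_homog Y_spec) => //.
- case=> [//|k s'] _ s'_neq0; rewrite prod_pencil //; exact: trP.
- by rewrite letter_w /= s_neq0.
by rewrite letter_w big_cons prod_pencil // size_s.
Qed.

End Pencil.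

(** * Indecomposable traces of orthogonal invariants *)

Section Orthogonal.
Local Open Scope ring_scope.
Variables (F : fieldType) (p : nat).
Hypothesis F_char : p \in [pchar F].

Let p_gt0 : (0 < p)%N. Proof. exact/prime_gt0/(pcharf_prime F_char). Qed.
Let i0 : 'I_p := Ordinal p_gt0.

Lemma mxtrace_delta : \tr (delta_mx i0 i0 : 'M[F]_p) = 1.
Proof.
rewrite /mxtrace (bigD1 i0) //= mxE !eqxx big1 ?addr0 // => i ne_i.
by rewrite mxE (negPf ne_i).
Qed.

Lemma x_homog (n d : nat) (i j : 'I_n) (k : 'I_d) : x F i j k \is 1.-homog.
Proof. by rewrite dhomogX /= mdeg1. Qed.

Section Symmetric.
Variable q : nat.

Definition corner (a : 'M[F]_p) : 'M[F]_(p + q) := block_mx a 0 0 0.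

Lemma cornerM a b : corner a * corner b = corner (a *m b).
Proof. by rewrite -mulmxE mulmx_block !mulmx0 !mul0mx !addr0. Qed.

Lemma mxtrace_corner a : \tr (corner a) = \tr a.
Proof. by rewrite mxtrace_block mxtrace0 addr0. Qed.

Lemma tr_corner a : (corner a)^T = corner a^T.
Proof. by rewrite tr_block_mx !trmx0. Qed.

Variable d : nat.
Let E := corner (delta_mx i0 i0).
Let P := corner 1%:M.

Lemma cornerM_expr a m : corner a * P ^+ m = corner a.
Proof.
by elim: m => [|m IHm]; rewrite ?mulr1 // exprSr mulrA IHm cornerM mulmx1.
Qed.

Lemma traceless_corner m : \tr (P ^+ m.+1) = 0.
Proof. by rewrite exprS cornerM_expr mxtrace_corner mxtrace1 pcharf0. Qed.

Lemma trace_corner_neq0 m : \tr (E * P ^+ m) != 0.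
Proof. by rewrite cornerM_expr mxtrace_corner mxtrace_delta oner_neq0. Qed.

Lemma pencil_sym (k : 'I_d.+1) i j : pencil E P k i j = pencil E P k j i.
Proof.
have [E_sym P_sym] : E^T = E /\ P^T = P.
  by rewrite !tr_corner trmx_delta trmx1.
by rewrite /pencil; case: eqP => _; rewrite -[in LHS](E_sym, P_sym) mxE.
Qed.

Lemma ROplus_degree : indecomposable_degree (ROplus F (p + q) d.+1) d.+1.
Proof.
apply: (pencil_degree (E := E) (P := P) (letter := id) (spell := id)) => //.
- by rewrite addn_gt0 p_gt0.
- by move=> k i j; rewrite mxE; case: ifP => _; apply: x_homog.
- move=> k; apply/matrixP=> i j; rewrite !mxE.
  by case: ifP => _; rewrite specialize_x ?[pencil _ _ _ j i]pencil_sym mulrC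
       mul_mpolyC.
- exact: traceless_corner.
exact: trace_corner_neq0.
Qed.

Lemma RO_degree : indecomposable_degree (RO F (p + q) d.+1) d.+1.
Proof.
apply: (pencil_degree (E := E) (P := P) (spell := inl)
  (letter := fun k => match k with inl k => k | inr k => k end)) => //.
- by rewrite addn_gt0 p_gt0.
- by case=> k i j; rewrite !mxE; apply: x_homog.
- case=> k; apply/matrixP=> i j; rewrite !mxE specialize_x mulrC mul_mpolyC //.
  by rewrite pencil_sym.
- exact: traceless_corner.
exact: trace_corner_neq0.
Qed.

End Symmetric.

Section Skew.
Variable q : nat.
Hypothesis p_odd : (2 < p)%N.

(** The tensor product of the skew matrix of size 2 with a, bordered by zeros. *)
Definition skew (a : 'M[F]_p) : 'M[F]_(p + p + q) :=
  block_mx (block_mx 0 (- a) a 0) 0 0 0.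

Lemma skewM a b :
  skew a * skew b = - block_mx (block_mx (a *m b) 0 0 (a *m b)) 0 0 0.
Proof.
rewrite -mulmxE !mulmx_block !mulmx0 !mul0mx !addr0 !add0r.
by rewrite mulNmx mulmxN !opp_block_mx !oppr0.
Qed.

Lemma skewMM a b c : skew a * skew b * skew c = - skew (a *m b *m c).
Proof.
rewrite skewM mulNr -mulmxE !mulmx_block !mulmx0 !mul0mx !addr0 !add0r.
by rewrite mulmxN.
Qed.

Lemma mxtrace_skew a : \tr (skew a) = 0.
Proof. by rewrite !mxtrace_block !mxtrace0 !addr0. Qed.

Lemma mxtrace_skewM a b : \tr (skew a * skew b) = - (\tr (a *m b) *+ 2).
Proof. by rewrite skewM raddfN /= !mxtrace_block mxtrace0 addr0. Qed.

Lemma tr_skew a : (skew a)^T = - skew a^T.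
Proof.
by rewrite !tr_block_mx !trmx0 !opp_block_mx !oppr0 opprK raddfN.
Qed.

Variable d : nat.
Let E := skew (delta_mx i0 i0).
Let P := skew 1%:M.

Lemma skewM_double a l : skew a * P ^+ l.*2 = (-1) ^+ l *: skew a.
Proof.
elim: l => [|l IHl]; first by rewrite mulr1 scale1r.
rewrite doubleS !exprSr mulrA mulrA IHl -!mulmxE -!scalemxAl !mulmxE.
by rewrite skewMM !mulmx1 mulrN1 scalerN scaleNr.
Qed.

Lemma traceless_skew m : \tr (P ^+ m.+1) = 0.
Proof.
rewrite exprS -(odd_double_half m); case: (odd m); last first.
  by rewrite skewM_double mxtraceZ mxtrace_skew mulr0.
rewrite add1n exprSr mulrA skewM_double -mulmxE -scalemxAl mulmxE.
by rewrite mxtraceZ mxtrace_skewM mulmx1 mxtrace1 pcharf0 // mul0rn oppr0 mulr0.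
Qed.

Lemma two_neq0 : 2%:R != 0 :> F.
Proof.
rewrite -(dvdn_pcharf F_char).
by apply: contraL p_odd => /dvdn_leq; rewrite -leqNgt; apply.
Qed.

Lemma trace_skew_neq0 l : \tr (E * P ^+ l.*2.+1) != 0.
Proof.
rewrite exprSr mulrA skewM_double -mulmxE -scalemxAl mulmxE.
rewrite mxtraceZ mxtrace_skewM mulmx1.
by rewrite mxtrace_delta mulf_neq0 ?signr_eq0 ?oppr_eq0 ?two_neq0.
Qed.

Lemma pencil_skew (k : 'I_d.+1) i j : pencil E P k i j = - pencil E P k j i.
Proof.
have [E_skew P_skew] : E^T = - E /\ P^T = - P.
  by rewrite !tr_skew trmx_delta trmx1.
have skewE (A : 'M[F]_(p + p + q)) : A^T = - A -> A i j = - A j i.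
  by move=> /matrixP/(_ j i); rewrite !mxE => ->.
by rewrite /pencil; case: eqP => _; apply: skewE.
Qed.

(** The words used have even length 2l + 2, an odd power of P being needed to
    make the trace of E P^e nonzero. *)
Lemma ROminus_degree l : (l.*2 < d)%N ->
  indecomposable_degree (ROminus F (p + p + q) d.+1) l.*2.+2.
Proof.
move=> lt_ld.
apply: (pencil_degree (E := E) (P := P) (letter := id) (spell := id)) => //.
- by rewrite !addn_gt0 p_gt0.
- move=> k i j; rewrite mxE; case: ifP => _; first exact: x_homog.
  by case: ifP => _; rewrite ?rpredN ?rpred0 ?x_homog.
- move=> k; apply/matrixP=> i j; rewrite !mxE [RHS]mulrC mul_mpolyC.
  case: ifP => _; first exact: specialize_x.
  case: eqP => [<- | _]; last first.
    by rewrite rmorphN /= specialize_x [pencil _ _ _ i j]pencil_skew scaleNr.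
  suff -> : pencil E P k i i = 0 by rewrite rmorph0 scale0r.
  (* Skewness gives 2 a = 0 for a diagonal entry a. *)
  have /eqP := pencil_skew k i i.
  by rewrite -addr_eq0 -mulr2n -mulr_natr mulf_eq0 (negPf two_neq0) orbF => /eqP.
- exact: traceless_skew.
exact: trace_skew_neq0.
Qed.

End Skew.
End Orthogonal.

Theorem corollary1p2 (F : fieldType) (p n d : nat)
    (F_infinite : ~ cardinality.finite_set (@classical_sets.setT F))
    (F_char : p \in [pchar F]%R)
    (n_ge2 : 2 <= n) (d_ge2 : 2 <= d) :
  (2 < p <= n ->
     leq_infty d (D (RO F n d)) /\ leq_infty d (D (ROplus F n d))) /\
  (2 < p /\ 2 * p <= n - 1 ->
     leq_infty (d - 1) (D (ROminus F n d))).
Proof.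
case: d d_ge2 => [//|d] d_gt0; split=> [/andP[_ le_pn] | [p_gt2 le_2pn]].
  rewrite -(subnKC le_pn); split; apply: leq_infty_D.
    exact: RO_degree.
  exact: ROplus_degree.
have le_ppn : p + p <= n.
  by rewrite addnn -mul2n (leq_trans le_2pn) ?leq_subr.
rewrite -(subnKC le_ppn) subn1 /=.
(* The largest even number up to d.+1. *)
apply: (leq_infty_trans (e := (d.-1)./2.*2.+2)).
  rewrite -ltnS -(prednK d_gt0) !ltnS -[X in X <= _]odd_double_half.
  by case: (odd _).
apply/leq_infty_D/ROminus_degree => //.
rewrite -[X in _ < X](prednK d_gt0) ltnS -[X in _ <= X]odd_double_half.
exact: leq_addl.
Qed.
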